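(* Let $p\ge 2$, $0<s<1$ and $N>ps$. Assume that $\Omega\subset\mathbb{R}^N$ is a bounded domain. Then for all $1<q<p$ there exists a positive constant $C=C(\Omega,q,N,s)$ (independent of $u$) such that for all $u\in\mathcal{C}_0^\infty(\Omega)$, $$\int_{\mathbb{R}^{N}}\int_{\mathbb{R}^{N}}\frac{|u(x)-u(y)|^p}{|x-y|^{N+ps}}\,\frac{dx}{|x|^{\beta}}\,\frac{dy}{|y|^{\beta}}\;\ge\; C\left(\int_{\Omega}\frac{|u(x)|^{p^*_{s,q}}}{|x|^{2\beta\frac{p^*_{s,q}}{p}}}\,dx\right)^{\frac{p}{p^*_{s,q}}},$$ where $p^*_{s,q}=\frac{pN}{N-qs}$ and $\beta=\frac{N-ps}{2}$.
   Context: $\mathcal{C}_0^\infty(\Omega)$ is the space of smooth functions with compact support in $\Omega$, extended by zero to $\mathbb{R}^N$. *)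

(* Defs.v *)
From HB Require Import structures.
From mathcomp Require Import all_boot all_order all_algebra.
From mathcomp Require Import all_classical all_reals all_analysis.

Set Implicit Arguments.
Unset Strict Implicit.
Unset Printing Implicit Defensive.

Import Order.TTheory GRing.Theory Num.Theory.
Import numFieldNormedType.Exports.

Local Open Scope classical_set_scope.
Local Open Scope ring_scope.

(* R^n is ['rV[R]_n], with the sigma-algebra generated by the coordinates:
   as R is second countable, this is the Borel sigma-algebra of R^n. *)
Definition rV_display : measure_display -> measure_display.
Proof. exact. Qed.

Section measurable_rV.
Context (R : realType) (n : nat).

Let coord (i : 'I_n) (x : 'rV[R]_n) : R := x 0 i.

Let rV_set0 : g_sigma_preimage coord set0.
Proof. exact: sigma_algebra0. Qed.

Let rV_setC A : g_sigma_preimage coord A -> g_sigma_preimage coord (~` A).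
Proof. exact: sigma_algebraC. Qed.

Let rV_bigcup (F : (set 'rV[R]_n)^nat) :
  (forall i, g_sigma_preimage coord (F i)) ->
  g_sigma_preimage coord (\bigcup_i (F i)).
Proof. exact: sigma_algebra_bigcup. Qed.

HB.instance Definition _ := @isMeasurable.Build
  (rV_display default_measure_display)
  'rV[R]_n (g_sigma_preimage coord) rV_set0 rV_setC rV_bigcup.

Lemma measurable_rV_coord (i : 'I_n) :
  measurable_fun [set: 'rV[R]_n] (fun x : 'rV[R]_n => x 0 i).
Proof.
move=> _ Y mY; rewrite setTI; apply: sub_sigma_algebra => /=.
rewrite -bigcup_seq/=; exists i => /=; first by rewrite mem_index_enum.
by exists Y => //; rewrite setTI.
Qed.

Lemma measurable_fun_rVP d (T : measurableType d) (f : T -> 'rV[R]_n) :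
  (forall i, measurable_fun [set: T] (fun t => f t 0 i)) ->
  measurable_fun [set: T] f.
Proof.
move=> mf.
suff : @g_sigma_preimage _ R _ n (fun i => coord i \o f) `<=` measurable.
  rewrite g_sigma_preimage_comp => mS _ A mA.
  by apply: mS; exists A.
apply: smallest_sub; first exact: sigma_algebra_measurable.
rewrite -bigcup_seq/=; apply: bigcup_sub => i _ A [B mB <-].
exact: mf.
Qed.

End measurable_rV.

Section lebesgue_rV.
Context {R : realType}.

(* (t, x_1, ..., x_n) as an element of R^(n+1) *)
Definition rV_cons n (tx : measurableTypeR R * 'rV[R]_n) : 'rV[R]_n.+1 :=
  \row_i (if unlift 0 i is Some j then tx.2 0 j else tx.1).

Definition rV_uncons n (x : 'rV[R]_n.+1) : measurableTypeR R * 'rV[R]_n :=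
  (x 0 0, \row_j x 0 (lift 0 j)).

Lemma rV_cons0 n tx : @rV_cons n tx 0 0 = tx.1.
Proof. by rewrite mxE unlift_none. Qed.

Lemma rV_consS n tx (j : 'I_n) : rV_cons tx 0 (lift 0 j) = tx.2 0 j.
Proof. by rewrite mxE liftK. Qed.

Lemma rV_consK n : cancel (@rV_cons n) (@rV_uncons n).
Proof.
move=> [t x]; congr pair; first by rewrite rV_cons0.
by apply/rowP => j; rewrite mxE rV_consS.
Qed.

Lemma rV_unconsK n : cancel (@rV_uncons n) (@rV_cons n).
Proof.
move=> x; apply/rowP => i; case: (unliftP 0 i) => [j|] ->.
  by rewrite rV_consS mxE.
by rewrite rV_cons0.
Qed.

Lemma measurable_rV_cons n : measurable_fun [set: _] (@rV_cons n).
Proof.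
apply: measurable_fun_rVP => i; case: (unliftP 0 i) => [j|] ->.
  under eq_fun do rewrite rV_consS.
  apply: (@measurableT_comp _ _ _ _ _ _ (fun x : 'rV[R]_n => x 0 j)) => //.
  exact: measurable_rV_coord.
under eq_fun do rewrite rV_cons0.
exact: measurable_fst.
Qed.

Lemma measurable_rV_uncons n : measurable_fun [set: _] (@rV_uncons n).
Proof.
apply: measurable_fun_pair; first exact: measurable_rV_coord.
apply: measurable_fun_rVP => j.
under eq_fun do rewrite mxE.
exact: measurable_rV_coord.
Qed.

Section step.
Context n (mu : {sigma_finite_measure set 'rV[R]_n -> \bar R}).

Definition lebesgue_rV_step : set 'rV[R]_n.+1 -> \bar R :=
  pushforward (lebesgue_measure \x mu)%E (@rV_cons n).

Let step0 : lebesgue_rV_step set0 = 0%E.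
Proof. by rewrite /lebesgue_rV_step /pushforward preimage_set0 measure0. Qed.

Let step_ge0 A : (0 <= lebesgue_rV_step A)%E.
Proof. by rewrite /lebesgue_rV_step /pushforward; exact: measure_ge0. Qed.

Let step_sigma_additive : semi_sigma_additive lebesgue_rV_step.
Proof.
have mV A : measurable A -> measurable (@rV_cons n @^-1` A).
  by move=> mA; rewrite -[X in measurable X]setTI; exact: measurable_rV_cons.
move=> F mF tF mUF; rewrite /lebesgue_rV_step /pushforward preimage_bigcup.
apply: measure_semi_sigma_additive.
- by move=> k; exact: mV.
- apply/trivIsetP => /= i j _ _ ij; rewrite -preimage_setI.
  by move/trivIsetP : tF => /(_ _ _ _ _ ij) ->//; rewrite preimage_set0.
- by rewrite -preimage_bigcup; exact: mV.
Qed.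

HB.instance Definition _ := isMeasure.Build _ _ _
  lebesgue_rV_step step0 step_ge0 step_sigma_additive.

Let step_sigma_finite : sigma_finite setT lebesgue_rV_step.
Proof.
have /sigma_finiteP[F [FT ndF Foo]] := sigma_finiteT (@lebesgue_measure R).
have /sigma_finiteP[G [GT ndG Goo]] := sigma_finiteT mu.
exists (fun k => @rV_uncons n @^-1` (F k `*` G k)).
  rewrite -preimage_bigcup (_ : \bigcup_k _ = setT) ?preimage_setT//.
  rewrite -setXTT FT GT predeqE => -[x y]; split.
    move=> [k _ []/= ? ?]; split; by exists k.
  move=> [/= [i _ Fix] [j _ Gjy]]; exists (maxn i j) => //; split.
  - by move: x Fix; exact/subsetPset/ndF/leq_maxl.
  - by move: y Gjy; exact/subsetPset/ndG/leq_maxr.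
move=> k; have [mF Fk] := Foo k; have [mG Gk] := Goo k; split.
  rewrite -[X in measurable X]setTI; apply: measurable_rV_uncons => //.
  exact: measurableX.
rewrite /lebesgue_rV_step /pushforward -comp_preimage.
rewrite (_ : _ \o _ = id) ?preimage_id; last exact/funext/rV_consK.
by rewrite product_measure1E// lte_mul_pinfty// ge0_fin_numE.
Qed.

HB.instance Definition _ :=
  Measure_isSigmaFinite.Build _ _ _ lebesgue_rV_step step_sigma_finite.

End step.

Fixpoint lebesgue_rV n : {sigma_finite_measure set 'rV[R]_n -> \bar R} :=
  if n is m.+1 then lebesgue_rV_step (lebesgue_rV m) else \d_(0 : 'rV[R]_0).

End lebesgue_rV.

Section smooth.
Context {R : realType} {N : nat}.
Implicit Types (u : 'rV[R]_N -> R) (Omega : set 'rV[R]_N).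

(* The library's norm on ['rV[R]_N] is the sup norm, hence a separate Euclidean
   norm. In quotients such as [a / enorm x `^ b] with [0 < b], the conventions
   [0 `^ b = 0] and [0^-1 = 0] replace a singular value by [0]; for [0 < N] this
   changes integrands on Lebesgue-null sets only. *)
Definition enorm (x : 'rV[R]_N) : R := Num.sqrt (\sum_i x 0 i ^+ 2).

Definition partial (i : 'I_N) u : 'rV[R]_N -> R := 'D_(delta_mx 0 i) u.

Definition smooth u := forall s : seq 'I_N,
  let v := foldr partial u s in
  continuous v /\ forall i x, derivable v x (delta_mx 0 i).

(* C_0^oo(Omega), for Omega open: such functions are extended by zero, so they
   are given as smooth functions on the whole of R^N. *)
Definition test_function Omega u :=
  let supp := closure [set x | u x != 0] in
  [/\ smooth u, compact supp & supp `<=` Omega].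

End smooth.

(* Main.v *)
Require Import Defs.
From HB Require Import structures.
From mathcomp Require Import all_boot all_order all_algebra.
From mathcomp Require Import all_classical all_reals all_analysis.
From mathcomp Require Import measurable_realfun ring lra.
Import Order.TTheory GRing.Theory Num.Theory.
Import numFieldNormedType.Exports.
Local Open Scope classical_set_scope.
Local Open Scope ring_scope.

Set Implicit Arguments.
Unset Strict Implicit.
Unset Printing Implicit Defensive.

(* Write rho_j = D 2^-j, where Omega lies in the sup-norm ball of radius D, and
   let m_j be the average of u over the ball of centre x and radius rho_j,
   except that m_0 is the average over a ball where u vanishes. As m_0 = 0 and
   m_j tends to u(x), some increment |m_j - m_(j+1)| exceeds c tau^j |u(x)|.
   Two applications of Jensen's inequality bound |m_j - m_(j+1)|^p by
   (1 + |x| / rho_j)^(2 beta) times the energy G(z) = int K(., z) integrated over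
   the ball of centre x and radius rho_j. Raising this to the power r/p, where
   r = p^*_(s,q), all but one power of the local energy is bounded by the total
   energy E. With a = 2 beta r / p = N (N - ps) / (N - qs) < N, Tonelli and
     int_(|x - z| <= rho) (1/|x| + 1/rho)^a dx <= C rho^(N - a)
   then bound the contribution of scale j by C E^(r/p) tau^(-rj) rho_j^(N - a),
   which is summable for tau close to 1: the subcritical exponent leaves the
   room N - a > 0. *)

(** * Borel measurability and cubes in R^n *)

Section rV_measure.
Context {R : realType}.

Lemma measurable_rV_box n (I : 'I_n -> set R) :
  (forall i, measurable (I i)) ->
  measurable [set x : 'rV[R]_n | forall i, I i (x 0 i)].
Proof.
move=> mI.
rewrite (_ : [set x | _] =
  \bigcap_(i in [set: 'I_n]) ((fun x : 'rV[R]_n => x 0 i) @^-1` I i)); last first.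
  by apply/seteqP; split => [x h i _|x h i]; exact: h.
apply: fin_bigcap_measurable => // i _.
rewrite -[X in measurable X]setTI.
exact: measurable_rV_coord.
Qed.

(** The sigma-algebra is generated by coordinates, not by the topology, so [U] is recovered as the
    countable union of the rational boxes that it contains. *)
Lemma open_measurable_rV n (U : set 'rV[R]_n) : open U -> measurable U.
Proof.
move=> oU.
pose box (k : 'rV[rat]_n * rat) : set 'rV[R]_n :=
  [set x | forall i, `]ratr (k.1 0 i) - ratr k.2, ratr (k.1 0 i) + ratr k.2[%classic (x 0 i)].
have -> : U = \bigcup_(k : 'rV[rat]_n * rat)
    (if pselect (box k `<=` U) then box k else set0).
  apply/seteqP; split => [x Ux|x [k _]]; last by case: pselect => // kU; exact: kU.
  have /nbhs_ballP[e /= e0 xeU] : nbhs x U by exact: open_nbhs_nbhs.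
  have [d] : exists d, ratr d \in `]0, e / 2[ by apply: rat_in_itvoo; rewrite divr_gt0.
  rewrite in_itv/= => /andP[d0 de].
  (* Choosing each centre coordinate within [d] of that of x keeps x in the box, and every point of
     the box is then within 2 d < e of x. *)
  have /choice[k kP] : forall i, exists k, ratr k \in `]x 0 i - ratr d, x 0 i + ratr d[.
    by move=> i; apply: rat_in_itvoo; lra.
  exists (\row_i k i, d) => //.
  have xk : box (\row_i k i, d) x.
    by move=> i /=; have := kP i; rewrite !mxE !in_itv/= => /andP[? ?]; lra.
  case: pselect => // nU; exfalso; apply: nU => y yk; apply: xeU; split => // i j.
  rewrite ord1; have := xk j; have := yk j; rewrite /= !in_itv/= !mxE.
  move=> /andP[? ?] /andP[? ?]; rewrite /ball/= /ball_ ltr_norml; lra.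
apply: countable_bigcupT_measurable; first exact: countableP.
move=> k; case: pselect => ? /=; last exact: measurable0.
by apply: (@measurable_rV_box _ (fun i =>
  `]ratr (k.1 0 i) - ratr k.2, ratr (k.1 0 i) + ratr k.2[%classic)).
Qed.

Lemma continuous_measurable_rV n (f : 'rV[R]_n -> R) :
  continuous f -> measurable_fun setT f.
Proof.
move=> /continuousP cf mT; apply: (measurability _ (RGenOpens.measurableE R)) => //.
move=> _ [_ [a [b ->] <-]]; rewrite setTI; apply: open_measurable_rV.
by apply/cf/interval_open.
Qed.

Lemma mx_norm_le n (x : 'rV[R]_n) (r : R) :
  0 <= r -> (`|x| <= r) <-> (forall i, `|x 0 i| <= r).
Proof.
move=> r0; split => [xr i|h].
  apply: le_trans xr; rewrite /Num.norm/= mx_normrE.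
  exact: (le_bigmax _ (fun ij : 'I_1 * 'I_n => `|x ij.1 ij.2|) (0, i)).
rewrite /Num.norm/= mx_normrE; apply/bigmax_leP; split => //= -[i j] _ /=.
by rewrite ord1.
Qed.

Definition cball n (c : 'rV[R]_n) (r : R) : set 'rV[R]_n := [set x | `|x - c| <= r].

Lemma cballE n (c : 'rV[R]_n) r : 0 <= r ->
  cball c r = [set x | forall i, `[c 0 i - r, c 0 i + r]%classic (x 0 i)].
Proof.
move=> r0; apply/seteqP; split => x /=.
  move=> /(mx_norm_le _ r0) h i; have := h i.
  by rewrite !mxE ler_norml /= in_itv/= => /andP[? ?]; lra.
move=> h; apply/(mx_norm_le _ r0) => i; have := h i.
by rewrite !mxE ler_norml /= in_itv/= => /andP[? ?]; lra.
Qed.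

Lemma measurable_cball n (c : 'rV[R]_n) r : measurable (cball c r).
Proof.
have [r0|r0] := leP 0 r.
  rewrite cballE //.
  by apply: (@measurable_rV_box _ (fun i => `[c 0 i - r, c 0 i + r]%classic)).
rewrite (_ : cball c r = set0) //; apply/seteqP; split => // x /= xr.
by have := lt_le_trans (le_lt_trans xr r0) (normr_ge0 (x - c)); rewrite ltxx.
Qed.

(** Induction on the dimension: a sup-norm ball is a cube, so its preimage under [rV_cons] is an
    interval times a ball of one dimension less. *)
Lemma lebesgue_rV_cball n (c : 'rV[R]_n) r : 0 <= r ->
  lebesgue_rV n (cball c r) = ((2 * r) ^+ n)%:E.
Proof.
move=> r0; elim: n c => [|n IH] c.
  rewrite expr0 /= diracE; rewrite mem_set //= /cball/=.
  by rewrite (_ : 0 - c = 0) ?normr0 //; apply/rowP => -[].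
rewrite /= /lebesgue_rV_step /pushforward.
rewrite (_ : _ @^-1` _ = `[c 0 0 - r, c 0 0 + r]%classic `*`
   cball (\row_j c 0 (lift 0 j)) r); last first.
  rewrite !cballE //; apply/seteqP; split => -[t y] /=.
    move=> h; split; first by have := h 0; rewrite rV_cons0.
    by move=> i; have := h (lift 0 i); rewrite rV_consS mxE.
  move=> [h0 h] i; case: (unliftP 0 i) => [j|] ->; last by rewrite rV_cons0.
  by rewrite rV_consS; have := h j; rewrite mxE.
rewrite product_measure1E //; last exact: measurable_cball.
have L : lebesgue_measure (`[c 0 0 - r, c 0 0 + r]%classic : set R) = (2 * r)%:E.
  rewrite lebesgue_measure_itv/= lte_fin; have [rr|rr] := ltP (c 0 0 - r) (c 0 0 + r).
    by rewrite -EFinD; congr _%:E; lra.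
  by have -> : r = 0 by [lra]; rewrite mulr0.
by rewrite IH exprS EFinM; congr (_ * _)%E.
Qed.

End rV_measure.

Lemma measurable_fun_powR d (T : measurableType d) (R : realType) (D : set T)
    (f : T -> R) (b : R) :
  measurable_fun D f -> measurable_fun D (fun x => f x `^ b).
Proof.
by move=> mf; apply: (@measurableT_comp _ _ _ _ _ _ (@powR R ^~ b)).
Qed.

(** * Averages and Jensen's inequality *)

Section average.
Context d (T : measurableType d) (R : realType) (mu : {measure set T -> \bar R}).
Implicit Types (P : set T) (f : T -> R).

Definition avg P f : R := fine (\int[mu]_(x in P) (f x)%:E) / fine (mu P).

Lemma avg_dist P f (m c : R) : measurable P -> mu P = m%:E -> 0 < m ->
  mu.-integrable P (EFin \o f) ->
  ((`|avg P f - c| * m)%:E <= \int[mu]_(x in P) (`|f x - c|)%:E)%E.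
Proof.
move=> mP Pm m0 intf.
have intc : mu.-integrable P (EFin \o cst c).
  apply: measurable_bounded_integrable => //; first by rewrite Pm ltry.
  exact: bounded_cst.
have If : (\int[mu]_(x in P) (f x)%:E)%E \is a fin_num by exact: integrable_fin_num.
have -> : (`|avg P f - c| * m)%:E = `|\int[mu]_(x in P) ((f x - c)%:E)|%E.
  under eq_integral do rewrite EFinB.
  rewrite integralB_EFin //= integral_cst // Pm -(fineK If) -EFinM -EFinB /= .
  by rewrite -[X in _ * X](gtr0_norm m0) -normrM /avg Pm /= mulrBl divfK ?gt_eqF.
apply: le_abse_integral => //.
apply/measurable_EFinP; apply: measurable_funB => //.
by apply/measurable_EFinP; exact: measurable_int intf.
Qed.

(** A crude Young inequality: the product is at most h^p when w <= h, and at most w^p otherwise. *)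
Lemma powR_sub1_mul_le (p h w : R) : 1 <= p -> 0 <= h -> 0 <= w ->
  h `^ (p - 1) * w <= h `^ p + w `^ p.
Proof.
move=> p1 h0 w0; have p0 : 0 < p by lra.
have p10 : 0 <= p - 1 by lra.
have [wh|hw] := leP w h.
  apply: (@le_trans _ _ (h `^ p)); last by rewrite lerDl powR_ge0.
  by rewrite -(mulr_powRB1 h0 p0) mulrC ler_wpM2r // powR_ge0.
apply: (@le_trans _ _ (w `^ p)); last by rewrite lerDr powR_ge0.
rewrite -(mulr_powRB1 w0 p0) mulrC ler_wpM2l //.
by apply: ge0_ler_powR => //; rewrite ?nnegrE //; exact: ltW.
Qed.

(* Jensen's inequality up to a factor 2^p: integrate [powR_sub1_mul_le] with h half
   the distance of the average to c. *)
Lemma avg_dist_powR P f (m c p : R) : measurable P -> mu P = m%:E -> 0 < m ->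
  1 <= p -> mu.-integrable P (EFin \o f) ->
  (((`|avg P f - c| / 2) `^ p * m)%:E <= \int[mu]_(x in P) (`|f x - c| `^ p)%:E)%E.
Proof.
move=> mP Pm m0 p1 intf.
have p0 : 0 < p by lra.
set h := `|avg P f - c| / 2; have h0 : 0 <= h by rewrite divr_ge0.
have mf : measurable_fun P (fun x => `|f x - c|).
  apply: measurableT_comp => //; apply: measurable_funB => //.
  by apply/measurable_EFinP; exact: measurable_int intf.
have mfp : measurable_fun P (fun x => `|f x - c| `^ p).
  exact: measurable_fun_powR.
have [J|J] := eqVneq (\int[mu]_(x in P) (`|f x - c| `^ p)%:E)%E +oo%E.
  by rewrite J leey.
(* As [2 * h] is the distance of the average to [c], [avg_dist] applies. The left side is 2 h^p m,
   and cancelling h^p m leaves the claim. *)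
have : ((h `^ (p - 1) * (2 * h * m))%:E <=
    (h `^ p * m)%:E + \int[mu]_(x in P) (`|f x - c| `^ p)%:E)%E.
  apply: (@le_trans _ _ ((h `^ (p - 1))%:E * \int[mu]_(x in P) (`|f x - c|)%:E)%E).
    rewrite EFinM lee_wpmul2l ?lee_fin ?powR_ge0 //.
    rewrite (_ : 2 * h * m = `|avg P f - c| * m); first exact: avg_dist.
    by rewrite /h; field.
  rewrite -ge0_integralZl_EFin //=; [|exact/measurable_EFinP|exact: powR_ge0].
  rewrite (_ : (h `^ p * m)%:E = \int[mu]_(x in P) (h `^ p)%:E)%E; last first.
    by rewrite integral_cst // Pm.
  rewrite -ge0_integralD //=;
    [|by move=> x _; rewrite lee_fin powR_ge0|exact/measurable_EFinP].
  apply: ge0_le_integral => //=.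
  - by move=> x _; rewrite -EFinM lee_fin mulr_ge0 // powR_ge0.
  - by apply/measurable_EFinP; apply: measurable_funM.
  - by apply/measurable_EFinP; apply: measurable_funD.
  - by move=> x _; rewrite -EFinM -EFinD lee_fin powR_sub1_mul_le.
have J0 : (0 <= \int[mu]_(x in P) (`|f x - c| `^ p)%:E)%E.
  by apply: integral_ge0 => x _; rewrite lee_fin powR_ge0.
have Jf : (\int[mu]_(x in P) (`|f x - c| `^ p)%:E)%E \is a fin_num.
  by rewrite ge0_fin_numE // ltey.
rewrite -(fineK Jf) -EFinD !lee_fin.
rewrite (_ : h `^ (p - 1) * (2 * h * m) = 2 * (h * h `^ (p - 1)) * m); last by ring.
rewrite mulr_powRB1 //; lra.
Qed.

End average.

Lemma eseries_geometric_le (R : realType) (c g : R) : 0 <= c -> 0 <= g -> g < 1 ->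
  (\sum_(0 <= k <oo) (c * g ^+ k)%:E <= (c / (1 - g))%:E)%E.
Proof.
move=> c0 g0 g1; apply: lime_le.
  by apply: is_cvg_ereal_nneg_natsum => k _; rewrite lee_fin mulr_ge0 // exprn_ge0.
apply: nearW => n; rewrite sumEFin lee_fin -mulr_sumr ler_wpM2l //.
rewrite -[leRHS]mul1r ler_pdivlMr; last by lra.
have gn : 0 <= g ^+ n by rewrite exprn_ge0.
rewrite big_mkord; have := subrX1 g n.
by set S := \sum_(i < n) _ => H; rewrite (_ : S * (1 - g) = 1 - g ^+ n); lra.
Qed.

(** * Punctured balls, and comparison of the Euclidean and sup norms *)

Section punctured.
Context {R : realType} {N : nat}.
Implicit Types (c x y z : 'rV[R]_N) (r : R).

(* Removing 0 leaves out the points where the kernel below takes a junk value. *)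
Definition pball c r : set 'rV[R]_N := cball c r `\ 0.

Lemma cball0 c : cball c 0 = [set c].
Proof.
apply/seteqP; split => x /=; last by move=> ->; rewrite /cball/= subrr normr0.
by rewrite /cball/= normr_le0 subr_eq0 => /eqP.
Qed.

Lemma measurable_rV_set1 c : measurable [set c].
Proof. by rewrite -cball0; exact: measurable_cball. Qed.

Lemma measurable_pball c r : measurable (pball c r).
Proof.
by apply: measurableD; [exact: measurable_cball|exact: measurable_rV_set1].
Qed.

Lemma lebesgue_rV_set1 c : (0 < N)%N -> lebesgue_rV N [set c] = 0%E.
Proof.
by move=> N0; rewrite -cball0 lebesgue_rV_cball // mulr0 expr0n gtn_eqF.
Qed.

Lemma lebesgue_rV_pball c r : (0 < N)%N -> 0 <= r ->
  lebesgue_rV N (pball c r) = ((2 * r) ^+ N)%:E.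
Proof.
move=> N0 r0; have L := lebesgue_rV_cball c r0.
rewrite /pball (measureD (measurable_cball c r) (measurable_rV_set1 0)); last first.
  by rewrite [ltLHS]L ltry.
rewrite [X in (X - _)%E]L.
rewrite [X in (_ - X)%E](_ : _ = 0%E) ?sube0 //.
apply/eqP; rewrite eq_le measure_ge0 andbT -[leRHS](lebesgue_rV_set1 0 N0).
apply: le_measure; rewrite ?inE.
- by apply: measurableI; [exact: measurable_cball|exact: measurable_rV_set1].
- exact: measurable_rV_set1.
- by move=> x [].
Qed.

Lemma norm_le_enorm x : `|x| <= enorm x.
Proof.
apply/mx_norm_le => [|i]; first exact: sqrtr_ge0.
rewrite -sqrtr_sqr; apply: ler_wsqrtr.
by rewrite (bigD1 i) //= lerDl sumr_ge0 // => j _; exact: sqr_ge0.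
Qed.

Lemma enorm_le x : enorm x <= Num.sqrt N%:R * `|x|.
Proof.
rewrite -[X in _ * X]ger0_norm // -sqrtr_sqr -sqrtrM //; apply: ler_wsqrtr.
have -> : N%:R * `|x| ^+ 2 = \sum_(i < N) `|x| ^+ 2.
  by rewrite sumr_const card_ord mulr_natl.
apply: ler_sum => i _; rewrite -real_normK ?num_real //.
rewrite ler_sqr ?nnegrE //; exact: (mx_norm_le x (normr_ge0 x)).1.
Qed.

Lemma enorm_gt0 x : x != 0 -> 0 < enorm x.
Proof. by move=> x0; rewrite (lt_le_trans _ (norm_le_enorm x)) // normr_gt0. Qed.

Lemma enorm0 : enorm (0 : 'rV[R]_N) = 0.
Proof.
by rewrite /enorm big1 ?sqrtr0 // => i _; rewrite mxE expr0n.
Qed.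

Lemma measurable_enorm : measurable_fun setT (@enorm R N).
Proof.
apply: (@measurableT_comp _ _ _ _ _ _ (@Num.sqrt R)).
  exact: continuous_measurable_fun (@sqrt_continuous R).
apply: measurable_sum => i; apply: measurable_funX.
exact: measurable_rV_coord.
Qed.

Lemma measurable_rV_norm : measurable_fun setT (fun x : 'rV[R]_N => `|x|).
Proof. exact: continuous_measurable_rV (@norm_continuous _ _). Qed.

Lemma measurable_rV_sub :
  measurable_fun setT (fun z : 'rV[R]_N * 'rV[R]_N => z.1 - z.2).
Proof.
apply: measurable_fun_rVP => i; under eq_fun do rewrite !mxE.
apply: measurable_funB.
- exact: (measurableT_comp (measurable_rV_coord i)).
- exact: (measurableT_comp (measurable_rV_coord i)).
Qed.

End punctured.

(** * The weighted Gagliardo kernel and its energy density *)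

Section kernel.
Context {R : realType} {N : nat}.
Variables (p s : R).
Hypotheses (p1 : 1 <= p) (s0 : 0 < s) (psN : p * s < N%:R).
Let X := 'rV[R]_N.
Let beta : R := (N%:R - p * s) / 2.
Variable u : X -> R.
Hypothesis cu : continuous u.

Let ps0 : 0 < p * s. Proof. by rewrite mulr_gt0 // (lt_le_trans ltr01). Qed.
Let mu_u : measurable_fun setT u. Proof. exact: continuous_measurable_rV. Qed.

Definition kern (x y : X) : R :=
  `|u x - u y| `^ p / enorm (x - y) `^ (N%:R + p * s)
   / enorm x `^ beta / enorm y `^ beta.

Lemma kern_ge0 x y : 0 <= kern x y.
Proof. by rewrite /kern !divr_ge0 // powR_ge0. Qed.

Lemma measurable_kern : measurable_fun setT (fun z : X * X => kern z.1 z.2).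
Proof.
rewrite /kern; under eq_fun do rewrite -!powRN.
have me (f : X * X -> X) :
    measurable_fun setT f -> measurable_fun setT (fun z => enorm (f z)).
  move=> mf; apply: (@measurableT_comp _ _ _ _ _ _ (@enorm R N)) => //.
  exact: measurable_enorm.
apply: measurable_funM; [apply: measurable_funM; [apply: measurable_funM|]|].
- apply: measurable_fun_powR; apply: measurableT_comp => //; apply: measurable_funB.
  + exact: (measurableT_comp mu_u).
  + exact: (measurableT_comp mu_u).
- by apply: measurable_fun_powR; apply: me; exact: measurable_rV_sub.
- by apply: measurable_fun_powR; apply: me; exact: measurable_fst.
- by apply: measurable_fun_powR; apply: me; exact: measurable_snd.
Qed.

Definition energy (y : X) : \bar R := (\int[lebesgue_rV N]_x (kern x y)%:E)%E.

Lemma energy_ge0 y : (0 <= energy y)%E.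
Proof. by apply: integral_ge0 => x _; rewrite lee_fin kern_ge0. Qed.

Lemma measurable_energy : measurable_fun setT energy.
Proof.
apply: (@measurable_fun_fubini_tonelli_G _ _ _ _ _ (lebesgue_rV N)
  (fun z : X * X => (kern z.1 z.2)%:E)).
- by apply/measurable_EFinP; exact: measurable_kern.
- by move=> z; rewrite lee_fin kern_ge0.
Qed.

(** An upper bound for the product of the denominators of [kern] at points of sup norm at most [h]
    and at distance at most [d]; the factors sqrt N come from [enorm_le]. *)
Definition kernC (d h : R) : R :=
  (Num.sqrt N%:R * d) `^ (N%:R + p * s) * (Num.sqrt N%:R * h) `^ (2 * beta).

(** Off the diagonal the numerator is [kern] times its denominators, each of which is increasing in
    a norm; on the diagonal the left side vanishes. *)
Lemma kern_lower x y d h : x != 0 -> y != 0 ->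
  `|x - y| <= d -> `|x| <= h -> `|y| <= h ->
  `|u x - u y| `^ p <= kernC d h * kern x y.
Proof.
move=> x0 y0 xyd xh yh.
have b0 : 0 < beta by rewrite /beta divr_gt0 // subr_gt0.
have Nps : 0 < N%:R + p * s by rewrite ltr_wpDl.
have [->|xy] := eqVneq x y.
  rewrite subrr normr0 powR0 ?gt_eqF ?(lt_le_trans ltr01) //.
  by rewrite mulr_ge0 ?kern_ge0 // mulr_ge0 // powR_ge0.
have := enorm_gt0 x0; have := enorm_gt0 y0.
have xy0 : x - y != 0 by rewrite subr_eq0.
have := enorm_gt0 xy0 => /[swap] ey /[swap] ex exy.
have pexy : 0 < enorm (x - y) `^ (N%:R + p * s) by exact: powR_gt0.
have pex : 0 < enorm x `^ beta by exact: powR_gt0.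
have pey : 0 < enorm y `^ beta by exact: powR_gt0.
rewrite [leLHS](_ : _ = (enorm (x - y) `^ (N%:R + p * s) *
    (enorm x `^ beta * enorm y `^ beta)) * kern x y).
  have bound (z : X) w : `|z| <= w -> enorm z <= Num.sqrt N%:R * w.
    by move=> zw; apply: (le_trans (enorm_le z)); apply: ler_wpM2l => //; exact: sqrtr_ge0.
  have bnn (z : X) w : `|z| <= w -> 0 <= Num.sqrt N%:R * w.
    by move=> zw; rewrite mulr_ge0 ?sqrtr_ge0 // (le_trans _ zw).
  apply: ler_wpM2r; first exact: kern_ge0.
  have b2 v : v `^ (2 * beta) = v `^ beta * v `^ beta.
    by rewrite mulr_natl mulr2n powRD // gt_eqF // addr_gt0.
  rewrite /kernC b2; apply: ler_pM; rewrite ?mulr_ge0 ?powR_ge0 //.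
    by apply: ge0_ler_powR; rewrite ?nnegrE ?(bnn (x - y)) ?bound // ?ltW.
  by apply: ler_pM; rewrite ?powR_ge0 //; apply: ge0_ler_powR;
    rewrite ?nnegrE ?(bnn x) ?(bnn y) ?(bnn (x - y)) ?bound // ?ltW.
rewrite /kern; field.
by rewrite !gt_eqF.
Qed.

End kernel.

(** * Comparison of averages over two balls by the energy *)

Section step.
Context {R : realType} {N : nat}.
Variables (p s : R).
Hypotheses (p1 : 1 <= p) (s0 : 0 < s) (psN : p * s < N%:R).
Let X := 'rV[R]_N.
Let beta : R := (N%:R - p * s) / 2.
Variables (u : X -> R) (M : R).
Hypothesis cu : continuous u.
Hypothesis bu : forall x, `|u x| <= M.

Let ps0 : 0 < p * s. Proof. by rewrite mulr_gt0 // (lt_le_trans ltr01). Qed.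
Let N0 : (0 < N)%N. Proof. by rewrite -(ltr_nat R) (lt_trans ps0). Qed.
Let mu_u : measurable_fun setT u. Proof. exact: continuous_measurable_rV. Qed.
Let K := kern p s u.
Let lam : {measure set X -> \bar R} := lebesgue_rV N.
Notation pavg c r := (avg lam (pball c r) u).

Lemma integrable_pball c r : 0 <= r -> lam.-integrable (pball c r) (EFin \o u).
Proof.
move=> r0; apply: measurable_bounded_integrable.
- exact: measurable_pball.
- by rewrite [ltLHS](lebesgue_rV_pball c N0 r0) ltry.
- exact: measurable_funTS.
- exists M; split; first exact: num_real.
  by move=> x Mx y _; apply: le_trans (bu y) (ltW Mx).
Qed.

Lemma measurable_kern_l y : measurable_fun setT (fun x => K x y).
Proof.
apply: (@measurableT_comp _ _ _ _ _ _ (fun z : X * X => K z.1 z.2) _ (fun x => (x, y))).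
  exact: measurable_kern.
exact: measurable_fun_pair.
Qed.

(** First use of Jensen, in y with z fixed: [kern_lower] inserts the kernel, and enlarging the
    domain from the ball to the whole space produces [energy] at z. *)
Lemma avg_energy c r z d h : 0 < r -> z != 0 -> `|z| <= h ->
  (forall y, pball c r y -> `|y - z| <= d /\ `|y| <= h) ->
  (((`|pavg c r - u z| / 2) `^ p * (2 * r) ^+ N)%:E
    <= (kernC p s d h (N := N))%:E * energy p s u z)%E.
Proof.
move=> r0 z0 zh dh.
have r20 : 0 < (2 * r) ^+ N by rewrite exprn_gt0 // mulr_gt0.
apply: (le_trans (avg_dist_powR (u z) (measurable_pball c r)
  (lebesgue_rV_pball c N0 (ltW r0)) r20 p1 (integrable_pball c (ltW r0)))).
have k0 : 0 <= kernC p s d h (N := N) by rewrite mulr_ge0 // powR_ge0.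
have mK D : measurable_fun D (fun x => (K x z)%:E).
  by apply/measurable_EFinP/measurable_funTS; exact: measurable_kern_l.
have mD := measurable_pball c r.
apply: (@le_trans _ _ (\int[lam]_(y in pball c r)
  ((kernC p s d h (N := N))%:E * (K y z)%:E))%E).
  apply: ge0_le_integral => //.
  - apply/measurable_EFinP.
    apply: measurable_fun_powR.
    by apply: measurableT_comp => //; apply: measurable_funB => //; exact: measurable_funTS.
  - by apply: emeasurable_funM => //; exact: measurable_cst.
  - move=> y yD; rewrite -EFinM lee_fin; have [yz yh] := dh _ yD.
    by apply: kern_lower => //; apply/eqP; case: yD.
rewrite ge0_integralZl_EFin //; last by move=> y _; rewrite lee_fin kern_ge0.
rewrite lee_wpmul2l ?lee_fin //; apply: ge0_subset_integral => //.
by move=> y _; rewrite lee_fin kern_ge0.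
Qed.

(** Second use of Jensen, now in z over the second ball, with the first average as the constant;
    [avg_energy] bounds the integrand. Each use halves the distance, hence the 4. *)
Lemma avg_step c1 r1 c2 r2 d h : 0 < r1 -> 0 < r2 ->
  (forall y, pball c1 r1 y -> `|y| <= h) -> (forall z, pball c2 r2 z -> `|z| <= h) ->
  (forall y z, pball c1 r1 y -> pball c2 r2 z -> `|y - z| <= d) ->
  (((`|pavg c1 r1 - pavg c2 r2| / 4) `^ p * ((2 * r1) ^+ N * (2 * r2) ^+ N))%:E
    <= (kernC p s d h (N := N))%:E * \int[lam]_(z in pball c2 r2) energy p s u z)%E.
Proof.
move=> r10 r20 h1 h2 dh.
have r1N : 0 < (2 * r1) ^+ N by rewrite exprn_gt0 // mulr_gt0.
have r2N : 0 < (2 * r2) ^+ N by rewrite exprn_gt0 // mulr_gt0.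
set mA := pavg c1 r1; set mB := pavg c2 r2.
have k0 : 0 <= kernC p s d h (N := N) by rewrite mulr_ge0 // powR_ge0.
have mD := measurable_pball c2 r2.
have mup : measurable_fun (pball c2 r2) (fun z => `|u z - mA| `^ p).
  apply: measurable_fun_powR.
  by apply: measurableT_comp => //; apply: measurable_funB => //; exact: measurable_funTS.
have H := avg_dist_powR mA mD (lebesgue_rV_pball c2 N0 (ltW r20)) r2N p1
  (integrable_pball c2 (ltW r20)).
(* [q] collects the factors of [avg_energy] independent of z: the halving and the volume of the
   first ball. *)
pose q := 2^-1 `^ p * (2 * r1) ^+ N.
have q0 : 0 <= q by rewrite mulr_ge0 ?powR_ge0 // ltW.
apply: (@le_trans _ _ (q%:E * \int[lam]_(z in pball c2 r2) (`|u z - mA| `^ p)%:E)%E).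
  apply: le_trans (lee_wpmul2l _ H); rewrite ?lee_fin //= -/mB.
  rewrite distrC (_ : `|mB - mA| / 4 = 2^-1 * (`|mB - mA| / 2)); last by field.
  by rewrite powRM // /q; rewrite le_eqVlt; apply/orP; left; apply/eqP; ring.
rewrite -ge0_integralZl_EFin //; [|exact/measurable_EFinP].
have mE D : measurable_fun D (energy p s u).
  by apply: measurable_funTS; exact: measurable_energy.
rewrite -ge0_integralZl_EFin //; [|by move=> z _; exact: energy_ge0].
apply: ge0_le_integral => //.
- by move=> z _; rewrite -EFinM lee_fin mulr_ge0 // powR_ge0.
- by apply: emeasurable_funM; [exact: measurable_cst|exact/measurable_EFinP].
- by apply: emeasurable_funM => //; exact: measurable_cst.
move=> z zD; have [zc /eqP z0] := zD.
apply: le_trans (avg_energy r10 z0 (h2 _ zD) (fun y yD => conj (dh _ _ yD zD) (h1 _ yD))).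
rewrite -EFinM lee_fin -/mA distrC.
rewrite [X in _ <= X `^ p * _]mulrC powRM // /q.
by rewrite le_eqVlt; apply/orP; left; apply/eqP; ring.
Qed.

End step.

(* Otherwise the increments would sum to at most [t / 2]. *)
Lemma exists_large_increment (R : realType) (m : nat -> R) (t tau : R) n :
  m 0%N = 0 -> 0 < tau -> tau < 1 -> 0 < t -> t / 2 < `|m n| ->
  exists j, (1 - tau) / 2 * t * tau ^+ j <= `|m j - m j.+1|.
Proof.
move=> m0 tau0 tau1 t0; apply: contraPP => /forallNP H; apply/negP; rewrite -leNgt.
suff : `|m n| <= (1 - tau ^+ n) * (t / 2).
  move=> /le_trans; apply; rewrite ler_piMl // ?divr_ge0 ?(ltW t0) //.
  by rewrite gerBl exprn_ge0 // ltW.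
elim: n => [|n IH]; first by rewrite m0 normr0 expr0 subrr mul0r.
have /negP := H n; rewrite -ltNge => Hn.
have : `|m n.+1| <= `|m n| + `|m n - m n.+1|.
  by rewrite -{1}(subrK (m n) (m n.+1)) addrC [in leRHS]distrC ler_normD.
rewrite exprS => T; have : 0 < tau ^+ n by rewrite exprn_gt0.
set P := tau ^+ n in Hn IH *; nra.
Qed.

(** Used with [m] a local and [E] the total energy: one power of the local energy stays linear, so
    that Tonelli can be applied to it later. *)
Lemma powR_le_mul (R : realType) (b m E : R) : 1 <= b -> 0 <= m -> m <= E ->
  m `^ b <= E `^ (b - 1) * m.
Proof.
move=> b1 m0 mE; have b0 : 0 < b by lra.
rewrite -(mulr_powRB1 m0 b0) mulrC ler_wpM2r //.
by apply: ge0_ler_powR; rewrite ?nnegrE ?subr_ge0 // (le_trans m0).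
Qed.

(** * Pointwise bound of u by local energies *)

Section pointwise.
Context {R : realType} {N : nat}.
Variables (p s : R).
Hypotheses (p1 : 1 <= p) (s0 : 0 < s) (psN : p * s < N%:R).
Let X := 'rV[R]_N.
Let beta : R := (N%:R - p * s) / 2.
Let lam : {measure set X -> \bar R} := lebesgue_rV N.
Let ps0 : 0 < p * s. Proof. by rewrite mulr_gt0 // (lt_le_trans ltr01). Qed.
Let N0 : (0 < N)%N. Proof. by rewrite -(ltr_nat R) (lt_trans ps0). Qed.
Let p0 : 0 < p. Proof. exact: lt_le_trans ltr01 p1. Qed.
Let b0 : 0 < 2 * beta. Proof. by rewrite /beta mulr_gt0 // divr_gt0 // subr_gt0. Qed.

(** The factor 4^p undoes the division by 4 in [avg_step], 2^N comes from the volumes of the balls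
    of radii rho and rho / 2, and 6 and 5 from the distances in [avg_increment]. *)
Definition stepC : R := 4 `^ p * (2 ^+ N)^-1 *
  (Num.sqrt N%:R * 6) `^ (N%:R + p * s) * (Num.sqrt N%:R * 5) `^ (2 * beta).

Lemma stepC_gt0 : 0 < stepC.
Proof.
have sN : 0 < Num.sqrt N%:R :> R by rewrite sqrtr_gt0 ltr0n.
by rewrite /stepC !mulr_gt0 ?invr_gt0 ?exprn_gt0 ?powR_gt0 ?mulr_gt0.
Qed.

(** Scale invariance: N + p s + 2 beta = 2 N, so the powers of rho from the kernel bound cancel
    those from the two volumes, and only the ratio (y + rho) / rho remains. *)
Lemma stepC_bound (w rho y m : R) : 0 <= w -> 0 < rho -> 0 <= y -> 0 <= m ->
  (w / 4) `^ p * ((2 * rho) ^+ N * (2 * (rho / 2)) ^+ N)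
     <= kernC p s (6 * rho) (5 * (y + rho)) (N := N) * m ->
  w `^ p <= stepC * ((y + rho) / rho) `^ (2 * beta) * m.
Proof.
move=> w0 rho0 y0 m0; rewrite /kernC -/beta.
have sN : 0 <= Num.sqrt N%:R :> R by rewrite sqrtr_ge0.
have v0 : 0 <= y + rho by rewrite addr_ge0 // ltW.
set v := y + rho in v0 *.
have -> : w `^ p = 4 `^ p * (w / 4) `^ p.
  by rewrite -powRM ?divr_ge0 //; congr (_ `^ _); field.
have -> : Num.sqrt N%:R * (6 * rho) = (Num.sqrt N%:R * 6) * rho by ring.
have -> : Num.sqrt N%:R * (5 * v) = (Num.sqrt N%:R * 5) * ((v / rho) * rho).
  by field; rewrite gt_eqF.
have vr0 : 0 <= v / rho by rewrite divr_ge0 // ltW.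
rewrite (powRM _ _ (ltW rho0)) ?mulr_ge0 //.
rewrite [(_ * (v / rho * rho)) `^ _]powRM ?(mulr_ge0 vr0) ?mulr_ge0 ?(ltW rho0) //.
rewrite (powRM _ vr0 (ltW rho0)).
have E : rho `^ (N%:R + p * s) * rho `^ (2 * beta) = rho ^+ N * rho ^+ N.
  rewrite -powRD; last by rewrite gt_eqF ?addr_gt0 // ltr0n.
  rewrite (_ : N%:R + p * s + 2 * beta = (N + N)%:R); last by rewrite natrD /beta; field.
  by rewrite powR_mulrn ?(ltW rho0) // exprD.
have -> : 2 * (rho / 2) = rho by field.
have P0 : 0 < rho ^+ N * rho ^+ N by rewrite mulr_gt0 // exprn_gt0.
have T0 : 0 < 2 ^+ N :> R by rewrite exprn_gt0.
rewrite exprMn.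
set S6 := (_ * 6) `^ _; set S5 := (_ * 5) `^ _; set V := (v / rho) `^ _.
set A := (w / 4) `^ p => H.
have {}H : A * 2 ^+ N <= S6 * S5 * V * m.
  rewrite -(ler_pM2r P0); apply: le_trans (le_trans _ H) _.
    by rewrite le_eqVlt; apply/orP; left; apply/eqP; ring.
  by rewrite -E le_eqVlt; apply/orP; left; apply/eqP; ring.
rewrite /stepC -/S6 -/S5.
have -> : 4 `^ p * (2 ^+ N)^-1 * S6 * S5 * V * m = 4 `^ p * ((S6 * S5 * V * m) / 2 ^+ N).
  by ring.
by rewrite ler_wpM2l ?powR_ge0 // ler_pdivlMr.
Qed.

Variables (u : X -> R) (M : R).
Hypothesis cu : continuous u.
Hypothesis bu : forall x, `|u x| <= M.
Notation pavg c r := (avg lam (pball c r) u).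

Lemma avg_near x c r e : 0 < r ->
  (forall y, pball c r y -> `|u y - u x| <= e) -> `|pavg c r - u x| <= e.
Proof.
move=> r0 H; have rN : 0 < (2 * r) ^+ N by rewrite exprn_gt0 // mulr_gt0.
have mD := measurable_pball c r.
have L := lebesgue_rV_pball c N0 (ltW r0).
have iu := integrable_pball p1 s0 psN cu bu c (ltW r0).
have := avg_dist (u x) mD L rN iu.
rewrite -/(avg _ _ _) => T; rewrite -(ler_pM2r rN) -lee_fin.
apply: (le_trans T); apply: (@le_trans _ _ (\int[lam]_(y in pball c r) (e%:E))%E); last first.
  by rewrite integral_cst // [X in (_ * X <= _)%E]L.
apply: ge0_le_integral => //.
by apply/measurable_EFinP; apply: measurableT_comp => //; apply: measurable_funB => //;
   apply: measurable_funTS; exact: continuous_measurable_rV.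
Qed.

Variable D : R.
Hypotheses (D0 : 0 < D) (vu : forall y, D < `|y| -> u y = 0).

Local Notation rad j := (D / 2 ^+ j).
(** The ball of index 0, of radius [D], is moved to a centre with all coordinates 3 D, where u
    vanishes; this starts the telescoping at 0. *)
Let ctr (x : X) j : X := if j is 0%N then const_mx (3 * D) else x.

Let rad_gt0 j : 0 < rad j. Proof. by rewrite divr_gt0 // exprn_gt0. Qed.
Let radS j : rad j.+1 = rad j / 2.
Proof. by rewrite exprSr; field; rewrite gt_eqF // exprn_gt0. Qed.

(** The coordinates of a point of this ball are at least 2 D, so its norm exceeds [D]. *)
Lemma avg_far : pavg (const_mx (3 * D)) D = 0.
Proof.
rewrite /avg (_ : (\int[lam]_(x in _) _)%E = 0%E) ?mul0r //.
apply: integral0_eq => y [yD _]; rewrite vu //.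
pose i := Ordinal N0.
have := (mx_norm_le _ (ltW D0)).1 yD i; have := (mx_norm_le y (normr_ge0 y)).1 (lexx _) i.
by rewrite !mxE => ?; rewrite ler_norml => /andP[? ?]; move: D0 (ler_norm (y 0 i)); lra.
Qed.

Lemma ctr_dist x j : `|x| <= D -> `|ctr x j - x| <= 4 * rad j.
Proof.
case: j => [|j] xD /=; last by rewrite subrr normr0 mulr_ge0 // ltW.
have -> : 4 * rad 0 = 3 * D + D by rewrite expr0 divr1; ring.
apply: le_trans (ler_normB _ _) _; apply: lerD => //.
apply/mx_norm_le => [|i]; first by rewrite mulr_ge0 // ltW.
by rewrite mxE ger0_norm // mulr_ge0 // ltW.
Qed.

(** By [ctr_dist], a point y of the ball at scale j is within 5 [rad j] of x, even for the displaced
    ball j = 0, and a point z of the next ball is within [rad j]. Hence |y - z| <= 6 [rad j], and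
    both norms are at most 5 (|x| + [rad j]). *)
Lemma avg_increment x j E : `|x| <= D ->
  (\int[lam]_(z in pball x (rad j.+1)) energy p s u z = E%:E)%E ->
  `|pavg (ctr x j) (rad j) - pavg x (rad j.+1)| `^ p
    <= stepC * ((`|x| + rad j) / rad j) `^ (2 * beta) * E.
Proof.
move=> xD EE; have r0 := rad_gt0 j.
have E0 : 0 <= E.
  by rewrite -lee_fin -EE; apply: integral_ge0 => z _; exact: energy_ge0.
apply: stepC_bound => //; rewrite -lee_fin -radS [leRHS]EFinM -EE.
have cd := ctr_dist j xD.
have Y y : pball (ctr x j) (rad j) y -> `|y - x| <= 5 * rad j.
  move=> [yc _]; have := ler_normD (y - ctr x j) (ctr x j - x).
  by rewrite addrA subrK; move: yc; rewrite /cball/=; lra.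
have Z z : pball x (rad j.+1) z -> `|z - x| <= rad j.
  by move=> [zx _]; move: zx; rewrite /cball/= radS; lra.
have W y : `|y - x| <= 5 * rad j -> `|y| <= 5 * (`|x| + rad j).
  by have := ler_normD (y - x) x; rewrite subrK; have := normr_ge0 x; lra.
apply: (avg_step p1 s0 psN cu bu) => //.
- by move=> y /Y /W.
- by move=> z /Z zx; apply: W; lra.
- move=> y z /Y yx /Z zx; have := ler_normB (y - x) (z - x).
  by rewrite opprB addrA subrK; lra.
Qed.

(** By continuity u, hence its average, stays within |u x| / 4 of u x on a small ball. The witness
    is a successor because the ball of index 0 is not centred at x. *)
Lemma avg_limit x : u x != 0 -> exists n,
  `|u x| / 2 < `|pavg (ctr x n) (rad n)|.
Proof.
move=> ux; have t0 : 0 < `|u x| by rewrite normr_gt0.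
have /cvgrPdist_lt Hu : u y @[y --> x] --> u x by exact: cu.
have t40 : 0 < `|u x| / 4 by rewrite divr_gt0.
have /nbhs_normP[e /= e0 H] := Hu _ t40.
have [n ne] : exists n, rad n.+1 < e.
  exists (Num.bound (D / e)); rewrite ltr_pdivrMr ?exprn_gt0 // mulrC -ltr_pdivrMr //.
  apply: lt_trans (archi_boundP _) _; first by rewrite divr_ge0 // ltW.
  by rewrite -natrX ltr_nat (ltn_trans (ltnSn _)) // ltn_expl.
exists n.+1 => /=.
have : `|pavg x (rad n.+1) - u x| <= `|u x| / 4.
  apply: avg_near => // y [yx _]; rewrite distrC; apply/ltW/H => /=.
  by rewrite distrC (le_lt_trans yx).
have := ler_normD (u x - pavg x (rad n.+1)) (pavg x (rad n.+1)).
by rewrite subrK distrC; lra.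
Qed.

(** The first factor inverts the constant of [exists_large_increment] raised to the power r; the
    second is the constant of [avg_increment] raised to r / p. *)
Definition pointC (tau r : R) : R := ((1 - tau) / 2) `^ (- r) * stepC `^ (r / p).

Lemma pointC_gt0 tau r : tau < 1 -> 0 < pointC tau r.
Proof.
by move=> t1; rewrite mulr_gt0 // powR_gt0 ?stepC_gt0 // divr_gt0 // subr_gt0.
Qed.

(** A large increment at some scale j dominates tau^j |u x|, and [avg_increment] bounds it by the
    energy near x. The scale depends on x; summing over all j later removes this dependence. *)
Lemma pointwise_bound tau r x E : 0 < tau -> tau < 1 -> p <= r ->
  (\int[lam]_z energy p s u z = E%:E)%E -> `|x| <= D -> x != 0 ->
  exists j, ((`|u x| `^ r / `|x| `^ (2 * beta * (r / p)))%:E <=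
    (pointC tau r * E `^ (r / p - 1) * (tau ^+ j) `^ (- r)
       * (`|x|^-1 + (rad j)^-1) `^ (2 * beta * (r / p)))%:E
    * \int[lam]_(z in cball x (rad j)) energy p s u z)%E.
Proof.
move=> t0 t1 pr EE xD x0; set a := 2 * beta * (r / p).
have nx0 : 0 < `|x| by rewrite normr_gt0.
have [ux|ux] := eqVneq (u x) 0.
  exists 0%N; rewrite ux normr0 powR0 ?mul0r; last first.
    by rewrite gt_eqF // (lt_le_trans p0).
  apply: mule_ge0; last by apply: integral_ge0 => z _; exact: energy_ge0.
  by rewrite lee_fin !mulr_ge0 ?powR_ge0 // ltW // pointC_gt0.
have [n Hn] := avg_limit ux.
have u0 : 0 < `|u x| by rewrite normr_gt0.
pose m_ k := pavg (ctr x k) (rad k).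
have m_0 : m_ 0%N = 0 by rewrite /m_ expr0 divr1; exact: avg_far.
have [j Hj] := exists_large_increment m_0 t0 t1 u0 Hn.
exists j.
have r0 := rad_gt0 j.
have mE S : measurable_fun S (energy p s u).
  by apply: measurable_funTS; exact: measurable_energy.
have eS (S S' : set X) : measurable S -> measurable S' -> S `<=` S' ->
    (\int[lam]_(z in S) energy p s u z <= \int[lam]_(z in S') energy p s u z)%E.
  by move=> mS mS' SS'; apply: ge0_subset_integral => // z _; exact: energy_ge0.
pose I := (\int[lam]_(z in pball x (rad j.+1)) energy p s u z)%E.
have I0 : (0 <= I)%E by apply: integral_ge0 => z _; exact: energy_ge0.
have IE : (I <= E%:E)%E by rewrite -EE; apply: eS => //; exact: measurable_pball.
have If : I \is a fin_num by rewrite ge0_fin_numE // (le_lt_trans IE) // ltry.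
(* The ball is enlarged from radius [rad j.+1] to [rad j], so that the weight and the domain involve
   the same scale. *)
apply: (@le_trans _ _ ((pointC tau r * E `^ (r / p - 1) * (tau ^+ j) `^ (- r)
       * (`|x|^-1 + (rad j)^-1) `^ a)%:E * I)%E); last first.
  apply: lee_wpmul2l.
    by rewrite lee_fin !mulr_ge0 ?powR_ge0 // ltW // pointC_gt0.
  apply: eS; [exact: measurable_pball|exact: measurable_cball|].
  by move=> z [zx _]; move: zx; rewrite /cball/= radS; move: r0; lra.
have := avg_increment xD (esym (fineK If)).
move: IE I0; rewrite -(fineK If) !lee_fin; set m := fine I => mE' m0.
rewrite -/(m_ j) -[pavg x _]/(m_ j.+1).
set w := `|m_ j - m_ j.+1| in Hj *; set rho := rad j in r0 *.
set V := (`|x| + rho) / rho; set k := (1 - tau) / 2 in Hj *; set tj := tau ^+ j in Hj * => Hw.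
have w0 : 0 <= w by exact: normr_ge0.
have k0 : 0 < k by rewrite divr_gt0 // subr_gt0.
have tj0 : 0 < tj by rewrite exprn_gt0.
have V0 : 0 <= V by rewrite divr_ge0 ?addr_ge0 ?ltW.
have rp1 : 1 <= r / p by rewrite ler_pdivlMr // mul1r.
have r0' : 0 <= r by rewrite (le_trans _ pr) // ltW.
have C0 := stepC_gt0.
(* The increment bound is raised to the power r / p >= 1, and [powR_le_mul] splits the power of the
   local energy. *)
have wr : w `^ r <= stepC `^ (r / p) * V `^ a * (E `^ (r / p - 1) * m).
  have -> : w `^ r = (w `^ p) `^ (r / p).
    by rewrite -powRrM mulrCA divff ?mulr1 // gt_eqF.
  apply: (@le_trans _ _ ((stepC * V `^ (2 * beta) * m) `^ (r / p))).
    apply: ge0_ler_powR;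
    by rewrite ?(le_trans ler01 rp1) ?nnegrE ?mulr_ge0 ?powR_ge0 ?(ltW C0).
  have Vb0 : 0 <= stepC * V `^ (2 * beta) by rewrite mulr_ge0 ?powR_ge0 ?(ltW C0).
  rewrite (powRM _ Vb0 m0) (powRM _ (ltW C0)) ?powR_ge0 // -powRrM -/a.
  by rewrite ler_wpM2l ?powR_le_mul // mulr_ge0 ?powR_ge0.
have kr : k `^ r * `|u x| `^ r * tj `^ r <= w `^ r.
  have kt0 : 0 <= k * `|u x| := mulr_ge0 (ltW k0) (ltW u0).
  rewrite -(powRM _ (ltW k0) (ltW u0)) -(powRM _ kt0 (ltW tj0)).
  by apply: ge0_ler_powR; rewrite ?nnegrE // (mulr_ge0 kt0 (ltW tj0)).
(* As V = |x| (1 / |x| + 1 / rho), the factor |x|^a moves to the left side as the Hardy-type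
   weight. *)
have VE : V `^ a = (`|x|^-1 + rho^-1) `^ a * `|x| `^ a.
  rewrite -powRM ?addr_ge0 ?invr_ge0 ?(ltW r0) //; congr (_ `^ _).
  by rewrite /V; field; rewrite ?gt_eqF.
rewrite /pointC -/k !powRN.
have kr0 : 0 < k `^ r by rewrite powR_gt0.
have tr0 : 0 < tj `^ r by rewrite powR_gt0.
have xa0 : 0 < `|x| `^ a by rewrite powR_gt0.
rewrite ler_pdivrMr //.
rewrite -(ler_pM2l kr0) -(ler_pM2r tr0); apply: (le_trans kr); apply: (le_trans wr).
rewrite VE le_eqVlt; apply/orP; left; apply/eqP.
by field; rewrite !gt_eqF.
Qed.

End pointwise.

(** * Integrals over balls of the weight singular at 0 *)

Lemma exists_dyadic (R : realType) (t : R) : 0 < t -> t <= 1 ->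
  exists k, (2^-1) ^+ k.+1 < t /\ t <= (2^-1) ^+ k.
Proof.
move=> t0 t1.
have ex : exists n, (2^-1) ^+ n < t.
  exists (Num.bound t^-1); rewrite exprVn invf_plt ?posrE ?exprn_gt0 //.
  apply: lt_trans (archi_boundP _) _; first by rewrite invr_ge0 ltW.
  by rewrite -natrX ltr_nat ltn_expl.
case: (ex_minnP ex) => -[|k] kt mk; first by move: kt; rewrite expr0 ltNge t1.
exists k; split => //; rewrite leNgt; apply/negP => /mk; by rewrite ltnn.
Qed.

Lemma nneseries_ge_term (R : realType) (f : nat -> \bar R) k :
  (forall i, (0 <= f i)%E) -> (f k <= \sum_(0 <= i <oo) f i)%E.
Proof.
move=> f0; rewrite (@nneseriesD1 _ f k xpredT) // leeDl //.
by apply: nneseries_ge0 => i _ _.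
Qed.

Section weight.
Context {R : realType} {N : nat}.
Let X := 'rV[R]_N.
Let lam : {measure set X -> \bar R} := lebesgue_rV N.
Variable a : R.
Hypotheses (a0 : 0 < a) (aN : a < N%:R).

Let g : R := 2 `^ (a - N%:R).
Let g0 : 0 < g. Proof. exact: powR_gt0. Qed.
Let g1 : g < 1.
Proof.
rewrite /g -opprB powRN invf_lt1 ?powR_gt0 //.
have : 1 `^ (N%:R - a) < 2 `^ (N%:R - a) :> R.
  by apply: gt0_ltr_powR; rewrite ?nnegrE ?subr_gt0 // ltr1n.
by rewrite powR1.
Qed.

(** The first term comes from the region |x| >= rho, the second from the geometric series over
    dyadic scales inside |x| < rho. *)
Definition weightC : R := 2 `^ a * 2 ^+ N + 4 `^ a * 2 ^+ N / (1 - g).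

Lemma weightC_gt0 : 0 < weightC.
Proof.
by rewrite /weightC addr_gt0 ?divr_gt0 ?mulr_gt0 ?powR_gt0 ?exprn_gt0 // subr_gt0.
Qed.

Lemma measurable_weight rho :
  measurable_fun setT (fun x : X => (`|x|^-1 + rho^-1) `^ a).
Proof.
apply: measurable_fun_powR; apply: measurable_funD => //.
have -> : (fun x : X => `|x|^-1) = (fun x : X => `|x| `^ (-1)).
  by apply/funext => x; rewrite powR_inv1.
apply: measurable_fun_powR; exact: measurable_rV_norm.
Qed.

(** A majorant of the weight on the dyadic annulus rho 2^-(k+1) < |x| <= rho 2^-k, supported on the
    whole ball of radius rho 2^-k because its volume is explicit. *)
Let annulus (rho : R) k (x : X) : R :=
  (4 * 2 ^+ k / rho) `^ a * \1_(cball 0 (rho * 2^-1 ^+ k)) x.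

Lemma weight_le rho (x : X) : 0 < rho ->
  (((`|x|^-1 + rho^-1) `^ a)%:E <= ((2 / rho) `^ a)%:E +
    \sum_(0 <= k <oo) (annulus rho k x)%:E)%E.
Proof.
move=> r0.
have T0 k : (0 <= (annulus rho k x)%:E)%E.
  by rewrite lee_fin mulr_ge0 ?powR_ge0.
have S0 : (0 <= \sum_(0 <= k <oo) (annulus rho k x)%:E)%E.
  by apply: nneseries_ge0 => k _ _; exact: T0.
have mono v w : 0 <= v -> v <= w -> v `^ a <= w `^ a.
  by move=> v0 vw; apply: ge0_ler_powR; rewrite ?nnegrE ?(ltW a0) // (le_trans v0).
have nn : 0 <= `|x|^-1 + rho^-1 by rewrite addr_ge0 ?invr_ge0 ?(ltW r0).
have ri : 0 < rho^-1 by rewrite invr_gt0.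
(* The first case includes x = 0, where the inverse is 0 by convention. *)
have [xr|xr] := leP (`|x|^-1) rho^-1.
  apply: (@le_trans _ _ ((2 / rho) `^ a)%:E); last by rewrite leeDl.
  by rewrite lee_fin; apply: mono => //; lra.
have x0 : 0 < `|x| by rewrite -invr_gt0 (lt_trans _ xr).
have {}xr : `|x| < rho by move: xr; rewrite ltf_pV2.
have [k [k1 k2]] : exists k, (2^-1) ^+ k.+1 < `|x| / rho /\ `|x| / rho <= (2^-1) ^+ k.
  by apply: exists_dyadic; [rewrite divr_gt0|rewrite ler_pdivrMr // mul1r ltW].
apply: (@le_trans _ _ (annulus rho k x)%:E); last first.
  apply: (@le_trans _ _ (\sum_(0 <= k <oo) (annulus rho k x)%:E)%E).
    exact: (nneseries_ge_term k T0).
  by rewrite leeDr // lee_fin powR_ge0.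
rewrite /annulus indicE mem_set ?mulr1; last first.
  by rewrite /cball/= subr0 mulrC -ler_pdivrMr.
rewrite lee_fin; apply: mono => //.
have xk : `|x|^-1 < 2 * 2 ^+ k / rho.
  move: k1; rewrite exprVn -ltf_pV2 ?posrE ?invr_gt0 ?exprn_gt0 ?divr_gt0 //.
  by rewrite invf_div invrK exprS ltr_pdivlMr // mulrC.
have rk : rho^-1 <= 2 ^+ k / rho by rewrite ler_peMl ?(ltW ri) // exprn_ege1 // ler1n.
(* The two inverses are at most 2 2^k / rho and 2^k / rho, so their sum is below 4 2^k / rho. *)
rewrite (_ : 4 * 2 ^+ k / rho = 2 * 2 ^+ k / rho + 2 * (2 ^+ k / rho)); last by ring.
lra.
Qed.

(** The bound is uniform in z: the constant part sees only the volume of the ball, and the singular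
    part is bounded on balls centred at 0. Its terms form a geometric series of ratio 2^(a - N),
    convergent because a < N. *)
Lemma weight_integral z rho : 0 < rho ->
  (\int[lam]_(x in cball z rho) ((`|x|^-1 + rho^-1) `^ a)%:E
    <= (weightC * rho `^ (N%:R - a))%:E)%E.
Proof.
move=> r0; have mD := measurable_cball z rho.
have mI k : measurable_fun (cball z rho)
  (fun x : X => (annulus rho k x)%:E).
  apply/measurable_EFinP; apply: measurable_funM => //.
  by apply: measurable_indic; exact: measurable_cball.
have T0 k x : (0 <= (annulus rho k x)%:E :> \bar R)%E.
  by rewrite lee_fin mulr_ge0 ?powR_ge0.
have S0 (x : X) : (0 <= \sum_(0 <= k <oo) (annulus rho k x)%:E)%E.
  by apply: nneseries_ge0 => k _ _; exact: T0.
have mS : measurable_fun (cball z rho) (fun x : X =>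
   (\sum_(0 <= k <oo) (annulus rho k x)%:E)%E).
  apply: ge0_emeasurable_sum => //.
apply: (@le_trans _ _ (\int[lam]_(x in cball z rho) (((2 / rho) `^ a)%:E +
    \sum_(0 <= k <oo) (annulus rho k x)%:E))%E).
  apply: ge0_le_integral => //.
  - by move=> x _; rewrite lee_fin powR_ge0.
  - by apply/measurable_EFinP/measurable_funTS; exact: measurable_weight.
  - by apply: emeasurable_funD => //; exact: measurable_cst.
  - by move=> x _; exact: weight_le.
rewrite ge0_integralD //; last by move=> x _; rewrite lee_fin powR_ge0.
rewrite integral_cst // [X in (_ * X + _)%E](lebesgue_rV_cball z (ltW r0)).
rewrite integral_nneseries //.
have ra : rho `^ (N%:R - a) = rho ^+ N / rho `^ a.
  rewrite powRD ?powR_mulrn ?(ltW r0) ?powRN //.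
  by rewrite gt_eqF // subr_gt0.
have ra0 : 0 < rho `^ a by rewrite powR_gt0.
have ria : rho^-1 `^ a = (rho `^ a)^-1.
  by rewrite -[rho^-1]powR_inv1 ?(ltW r0) // -powRrM mulN1r powRN.
rewrite (_ : (weightC * rho `^ (N%:R - a))%:E =
  ((2 `^ a * 2 ^+ N * rho `^ (N%:R - a))%:E
   + (4 `^ a * 2 ^+ N / (1 - g) * rho `^ (N%:R - a))%:E)%E); last first.
  by rewrite -EFinD -mulrDl.
apply: leeD.
  rewrite -EFinM lee_fin ra exprMn powRM ?invr_ge0 ?(ltW r0) // ria.
  by rewrite le_eqVlt; apply/orP; left; apply/eqP; field; rewrite gt_eqF.
apply: (@le_trans _ _ (\sum_(0 <= k <oo)
  ((4 `^ a * 2 ^+ N * rho `^ (N%:R - a)) * g ^+ k)%:E)%E); last first.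
  apply: le_trans (eseries_geometric_le _ (ltW g0) g1) _.
    by rewrite !mulr_ge0 ?powR_ge0 ?exprn_ge0.
  by rewrite lee_fin le_eqVlt; apply/orP; left; apply/eqP; ring.
apply: lee_nneseries => [k _ _|k _]; first by apply: integral_ge0 => x _; exact: T0.
have mB := measurable_cball (0 : X) (rho * 2^-1 ^+ k).
have rk0 : 0 <= rho * 2^-1 ^+ k by rewrite mulr_ge0 ?(ltW r0) ?exprn_ge0.
under eq_integral do rewrite /annulus EFinM.
rewrite ge0_integralZl_EFin ?powR_ge0 //; last first.
  by apply/measurable_EFinP; exact: measurable_indic.
rewrite integral_indic //.
apply: (@le_trans _ _ (((4 * 2 ^+ k / rho) `^ a)%:E * lam (cball 0 (rho * 2^-1 ^+ k)))%E).
  rewrite lee_wpmul2l ?lee_fin ?powR_ge0 //; apply: le_measure; rewrite ?inE //.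
  exact: measurableI.
rewrite [X in (_ * X <= _)%E](lebesgue_rV_cball 0 rk0) -EFinM lee_fin.
have gE : g ^+ k = (2 ^+ k) `^ a * (2^-1 ^+ k) ^+ N.
  have -> : g = 2 `^ a * (2 ^+ N)^-1.
    by rewrite /g powRD ?powRN ?powR_mulrn // subr_eq0 lt_eqF.
  rewrite exprMn; congr (_ * _); last by rewrite -exprM mulnC exprM exprVn.
  by rewrite -[2 ^+ k]powR_mulrn // -[LHS]powR_mulrn ?powR_ge0 // powRAC.
rewrite ra gE 2!exprMn (powRM _ _ (_ : 0 <= rho^-1)) ?powRM ?invr_ge0
  ?(ltW r0) ?mulr_ge0 ?exprn_ge0 // ria.
by rewrite le_eqVlt; apply/orP; left; apply/eqP; field; rewrite gt_eqF.
Qed.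

End weight.

(** * Tonelli for integrals over moving balls *)

Section convolution.
Context {R : realType} {N : nat}.
Let X := 'rV[R]_N.
Let lam := @lebesgue_rV R N.
Variables (w : X -> R) (G : X -> \bar R) (rho : R).
Hypotheses (mw : measurable_fun setT w) (w0 : forall x, 0 <= w x).
Hypotheses (mG : measurable_fun setT G) (G0 : forall x, (0 <= G x)%E).

(** Writing the moving ball as an indicator of x - z gives a jointly measurable integrand on the
    product. *)
Let H (z : X * X) : \bar R := ((w z.1 * \1_(cball 0 rho) (z.1 - z.2))%:E * G z.2)%E.

Let H0 z : (0 <= H z)%E.
Proof. by rewrite /H mule_ge0 // lee_fin mulr_ge0. Qed.

Let mH : measurable_fun setT H.
Proof.
apply: emeasurable_funM.
  apply/measurable_EFinP; apply: measurable_funM.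
    exact: (measurableT_comp mw).
  apply: (@measurableT_comp _ _ _ _ _ _ (\1_(cball 0 rho) : X -> R)).
    by apply: measurable_indic; exact: measurable_cball.
  exact: measurable_rV_sub.
exact: (measurableT_comp mG).
Qed.

Let in_cball (x z : X) : \1_(cball 0 rho) (x - z) = \1_(cball x rho) z :> R.
Proof.
rewrite !indicE; congr (_%:R); congr nat_of_bool.
by apply/idP/idP; rewrite !inE /cball/= subr0 distrC.
Qed.

Let convE x : (\int[lam]_z H (x, z) = (w x)%:E * \int[lam]_(z in cball x rho) G z)%E.
Proof.
rewrite -ge0_integralZl_EFin //; [|exact: measurable_cball|exact: measurable_funTS].
rewrite [RHS]integral_mkcond; apply: eq_integral => z _.
rewrite /H/= in_cball patchE indicE.
by case: (z \in cball x rho); rewrite ?mulr1 // mulr0 mul0e.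
Qed.

Lemma measurable_ball_integral :
  measurable_fun setT (fun x => (w x)%:E * \int[lam]_(z in cball x rho) G z)%E.
Proof.
rewrite (_ : (fun x => _ * _)%E = fubini_F lam H).
  exact: (@measurable_fun_fubini_tonelli_F _ _ _ _ _ lam H mH H0).
by apply/funext => x; rewrite /fubini_F convE.
Qed.

(** After the exchange of integrals, the symmetry of |x - z| <= rho makes the inner integral that of
    [w] over the ball centred at z, at most [C] uniformly in z. *)
Lemma integral_ball_integral (C : R) : 0 <= C ->
  (forall z, \int[lam]_(x in cball z rho) (w x)%:E <= C%:E)%E ->
  (\int[lam]_x ((w x)%:E * \int[lam]_(z in cball x rho) G z)
    <= C%:E * \int[lam]_z G z)%E.
Proof.
move=> C0 wC.
under eq_integral do rewrite -convE.
rewrite (@fubini_tonelli _ _ _ _ _ lam lam H mH H0) -ge0_integralZl_EFin //.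
apply: ge0_le_integral => //.
- by move=> z _; apply: integral_ge0.
- exact: (@measurable_fun_fubini_tonelli_G _ _ _ _ _ lam H mH H0).
- by apply: emeasurable_funM => //; exact: measurable_cst.
move=> z _; rewrite muleC.
have mW : measurable_fun (cball z rho) (EFin \o w).
  by apply/measurable_EFinP; exact: measurable_funTS.
apply: (@le_trans _ _ (G z * \int[lam]_(x in cball z rho) (w x)%:E)%E); last first.
  by rewrite lee_wpmul2l.
rewrite -ge0_integralZl //; [|exact: measurable_cball|by move=> x _; rewrite lee_fin].
rewrite [leRHS]integral_mkcond le_eqVlt; apply/orP; left; apply/eqP.
apply: eq_integral => x _; rewrite /H/= patchE indicE.
have -> : (x - z \in cball 0 rho) = (x \in cball z rho).
  by apply/idP/idP; rewrite !inE /cball/= subr0.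
by case: (x \in cball z rho); rewrite ?mulr1 ?mulr0 ?mul0e // muleC.
Qed.

End convolution.

(** * Summation over the scales *)

Section main.
Context {R : realType} {N : nat}.
Variables (p s r D : R).
Hypotheses (p1 : 1 <= p) (s0 : 0 < s) (psN : p * s < N%:R) (pr : p <= r) (D0 : 0 < D).
Let X := 'rV[R]_N.
Let a : R := 2 * ((N%:R - p * s) / 2) * (r / p).
Hypothesis aN : a < N%:R.

Let p0 : 0 < p. Proof. exact: lt_le_trans ltr01 p1. Qed.
Let r0 : 0 < r. Proof. exact: lt_le_trans p0 pr. Qed.
Let a0 : 0 < a.
Proof. by rewrite /a !mulr_gt0 ?invr_gt0 ?subr_gt0. Qed.

Let delta := N%:R - a.
Let delta0 : 0 < delta. Proof. by rewrite subr_gt0. Qed.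
(** Chosen so that tau^(-r) = 2^(delta / 2): the loss tau^(-r j) consumes half of the gain 2^(-delta
    j) of scale j, leaving the ratio [g]. *)
Let tau : R := 2 `^ (- (delta / (2 * r))).
Let g : R := 2 `^ (- (delta / 2)).
Let pow2_lt1 b : 0 < b -> 2 `^ (- b) < 1 :> R.
Proof.
move=> b0; rewrite powRN invf_lt1 ?powR_gt0 //.
have : 1 `^ b < 2 `^ b :> R by apply: gt0_ltr_powR; rewrite ?nnegrE // ltr1n.
by rewrite powR1.
Qed.
Let tau0 : 0 < tau. Proof. exact: powR_gt0. Qed.
Let tau1 : tau < 1. Proof. by apply: pow2_lt1; rewrite divr_gt0 // mulr_gt0. Qed.
Let g1 : g < 1. Proof. by apply: pow2_lt1; rewrite divr_gt0. Qed.
Let g0 : 0 < g. Proof. exact: powR_gt0. Qed.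

Let decay j : (tau ^+ j) `^ (- r) * (D / 2 ^+ j) `^ delta = D `^ delta * g ^+ j.
Proof.
have ex b k : (2 `^ b) ^+ k = 2 `^ (b * k%:R) :> R.
  by rewrite -powR_mulrn ?powR_ge0 // -powRrM.
have i2 : (2 ^+ j)^-1 = 2 `^ (- j%:R) :> R by rewrite powRN powR_mulrn.
rewrite /tau /g !ex i2 powRM ?powR_ge0 ?(ltW D0) // -!powRrM mulrCA -powRD; last first.
  by apply/implyP.
by congr (_ * 2 `^ _); field; rewrite gt_eqF.
Qed.

Definition mainC : R :=
  pointC p s tau r (N := N) * weightC a (N := N) * D `^ delta / (1 - g).

Lemma mainC_gt0 : 0 < mainC.
Proof.
rewrite /mainC divr_gt0 ?subr_gt0 // mulr_gt0 ?powR_gt0 // mulr_gt0 ?weightC_gt0 //.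
exact: pointC_gt0.
Qed.

Lemma weighted_sobolev (Omega : set X) (u : X -> R) (M E : R) :
  measurable Omega -> (forall x, Omega x -> `|x| <= D) -> continuous u ->
  (forall x, `|u x| <= M) -> (forall x, ~ Omega x -> u x = 0) ->
  (\int[lebesgue_rV N]_z energy p s u z = E%:E)%E ->
  (\int[lebesgue_rV N]_(x in Omega) (`|u x| `^ r / enorm x `^ a)%:E
    <= (mainC * E `^ (r / p))%:E)%E.
Proof.
move=> mO OD cu bu vO EE.
have E0 : 0 <= E.
  by rewrite -lee_fin -EE; apply: integral_ge0 => z _; exact: energy_ge0.
have vu y : D < `|y| -> u y = 0.
  by move=> yD; apply: vO => /OD; rewrite leNgt yD.
(* [c j] is the part of the pointwise bound independent of x, [w j] adds the weight, and [F j] is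
   the full contribution of scale j. *)
pose c j : R := pointC p s tau r (N := N) * E `^ (r / p - 1) * (tau ^+ j) `^ (- r).
have c0 j : 0 <= c j by rewrite /c !mulr_ge0 ?powR_ge0 // ltW // pointC_gt0.
pose rad j : R := D / 2 ^+ j.
have rad0 j : 0 < rad j by rewrite divr_gt0 // exprn_gt0.
pose w j (x : X) := c j * (`|x|^-1 + (rad j)^-1) `^ a.
have w0 j x : 0 <= w j x by rewrite mulr_ge0 ?powR_ge0.
have mw j : measurable_fun setT (w j).
  by apply: measurable_funM => //; exact: measurable_weight.
have mE : measurable_fun setT (energy p s u) by exact: measurable_energy.
pose F j x : \bar R :=
  ((w j x)%:E * \int[lebesgue_rV N]_(z in cball x (rad j)) energy p s u z)%E.
have F0 j x : (0 <= F j x)%E.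
  by rewrite /F mule_ge0 // ?lee_fin // integral_ge0 // => z _; exact: energy_ge0.
have mF j : measurable_fun setT (F j).
  by apply: measurable_ball_integral => // x; exact: energy_ge0.
have mu : measurable_fun setT u by exact: continuous_measurable_rV.
have mS : measurable_fun setT (fun x => \sum_(0 <= j <oo) F j x)%E.
  exact: ge0_emeasurable_sum.
have S0 x : (0 <= \sum_(0 <= j <oo) F j x)%E by apply: nneseries_ge0.
apply: (@le_trans _ _ (\int[lebesgue_rV N]_(x in Omega) \sum_(0 <= j <oo) F j x)%E).
  apply: ge0_le_integral => //.
  - by move=> x _; rewrite lee_fin divr_ge0 // powR_ge0.
  - apply/measurable_EFinP; under eq_fun do rewrite -powRN.
    apply: measurable_funM; apply: measurable_fun_powR; apply: measurable_funTS.
      exact: measurableT_comp.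
    exact: measurable_enorm.
  - exact: measurable_funTS.
  move=> x Ox.
  (* At the origin the integrand is 0 by the convention on inverses. *)
  have [->|x0] := eqVneq x 0.
    by rewrite enorm0 powR0 ?gt_eqF // invr0 mulr0.
  have [j Hj] := pointwise_bound p1 s0 psN cu bu D0 vu tau0 tau1 pr EE (OD _ Ox) x0.
  (* The sum over all scales dominates the one scale chosen for x; the Euclidean weight is below the
     sup-norm one because [enorm] dominates the sup norm. *)
  apply: le_trans (le_trans _ Hj) (nneseries_ge_term j (F0^~ x)).
  rewrite lee_fin ler_wpM2l ?powR_ge0 // lef_pV2 ?posrE ?powR_gt0 ?enorm_gt0 ?normr_gt0 //.
  by apply: ge0_ler_powR; rewrite ?nnegrE ?(ltW a0) ?norm_le_enorm ?sqrtr_ge0.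
apply: (@le_trans _ _ (\int[lebesgue_rV N]_x \sum_(0 <= j <oo) F j x)%E).
  exact: ge0_subset_integral.
rewrite integral_nneseries //.
(* Scale j contributes at most a multiple of g^j; the factor 1 - g cancels the denominator built
   into [mainC]. *)
apply: (@le_trans _ _ (\sum_(0 <= j <oo)
  ((mainC * (1 - g) * E `^ (r / p)) * g ^+ j)%:E)%E); last first.
  have K0 : 0 <= mainC * (1 - g) * E `^ (r / p).
    apply: mulr_ge0; last exact: powR_ge0.
    by apply: mulr_ge0; [exact: ltW mainC_gt0|rewrite subr_ge0 ltW].
  apply: le_trans (eseries_geometric_le K0 (ltW g0) g1) _.
  rewrite lee_fin le_eqVlt; apply/orP; left; apply/eqP; field.
  by rewrite subr_eq0 gt_eqF.
apply: lee_nneseries => [j _ _|j _]; first by apply: integral_ge0 => x _; exact: F0.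
have wC0 := weightC_gt0 aN.
have C0 : 0 <= c j * (weightC a (N := N) * rad j `^ delta).
  by rewrite mulr_ge0 // mulr_ge0 ?powR_ge0 ?(ltW wC0).
apply: le_trans (integral_ball_integral (rho := rad j) (mw j) (w0 j) mE _ C0 _) _.
- by move=> x; exact: energy_ge0.
- move=> z; rewrite /w; under eq_integral do rewrite EFinM.
  rewrite ge0_integralZl_EFin //; last 3 first.
  + exact: measurable_cball.
  + by move=> x _; rewrite lee_fin powR_ge0.
  + by apply/measurable_EFinP/measurable_funTS; exact: measurable_weight.
  by rewrite [leRHS]EFinM; apply: lee_wpmul2l; [rewrite lee_fin|exact: weight_integral].
rewrite EE -EFinM lee_fin /c /mainC.
have rp1 : 1 <= r / p by rewrite ler_pdivlMr // mul1r.
rewrite -(mulr_powRB1 E0 (lt_le_trans ltr01 rp1)).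
rewrite le_eqVlt; apply/orP; left; apply/eqP.
transitivity (pointC p s tau r (N := N) * weightC a (N := N) * (E * E `^ (r / p - 1)) *
  ((tau ^+ j) `^ (- r) * rad j `^ delta)); first by ring.
by rewrite decay; field; rewrite subr_eq0 gt_eqF.
Qed.

End main.

(** * Application to test functions *)

Lemma test_function_bounded (R : realType) (N : nat) (Omega : set 'rV[R]_N)
    (u : 'rV[R]_N -> R) :
  test_function Omega u -> exists M : R, forall x, `|u x| <= M.
Proof.
move=> [su cs _]; have [cu _] := su [::].
have cI : compact (u @` closure [set x | u x != 0]).
  by apply: continuous_compact => //; apply: continuous_subspaceT.
have [M M0 HM] := pinfty_ex_gt0 (compact_bounded cI).
exists M => x; have [->|ux] := eqVneq (u x) 0; first by rewrite normr0 ltW.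
by apply: HM; exists x => //; exact: subset_closure.
Qed.

Theorem theorem1p4 (R : realType) (N : nat) (p s : R)
    (hp : 2 <= p) (hs0 : 0 < s) (hs1 : s < 1) (hN : p * s < N%:R)
    (Omega : set 'rV[R]_N) (oOmega : open Omega) (cOmega : connected Omega)
    (nOmega : Omega !=set0) (bOmega : bounded_set Omega)
    (q : R) (hq1 : 1 < q) (hqp : q < p) :
  let beta : R := (N%:R - p * s) / 2 in
  let pstar : R := p * N%:R / (N%:R - q * s) in
  exists C : R, 0 < C /\
    forall u : 'rV[R]_N -> R, test_function Omega u ->
      (C%:E * (\int[lebesgue_rV N]_(x in Omega)
                 (`|u x| `^ pstar
                  / enorm x `^ (2 * beta * (pstar / p)))%:E) `^ (p / pstar)
       <= \int[lebesgue_rV N]_y \int[lebesgue_rV N]_x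
            (`|u x - u y| `^ p / enorm (x - y) `^ (N%:R + p * s)
             / enorm x `^ beta / enorm y `^ beta)%:E)%E.
Proof.
move=> beta pstar.
have p0 : 0 < p by lra.
have p1 : 1 <= p by lra.
have qs : q * s < p * s by rewrite ltr_pM2r.
have qs0 : 0 < q * s by rewrite mulr_gt0 //; lra.
have Nq : 0 < N%:R - q * s by lra.
have N0 : 0 < N%:R :> R by lra.
have rp : pstar / p = N%:R / (N%:R - q * s).
  by rewrite /pstar; field; rewrite ?gt_eqF.
have rp0 : 0 < pstar / p by rewrite rp divr_gt0.
have pr : p <= pstar.
  by rewrite /pstar -mulrA ler_pMr // ler_pdivlMr // mul1r; lra.
have r0 : 0 < pstar by lra.
(* The exponent is N (N - p s) / (N - q s), below N because q s < p s: this is where subcriticality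
   enters. *)
have aN : 2 * ((N%:R - p * s) / 2) * (pstar / p) < N%:R.
  rewrite rp (_ : _ * _ = N%:R * ((N%:R - p * s) / (N%:R - q * s))); last first.
    by field; rewrite gt_eqF.
  by rewrite gtr_pMr // ltr_pdivrMr // mul1r; lra.
have [D D0 HD] := pinfty_ex_gt0 bOmega.
pose C := mainC p s pstar D (N := N).
have C0 : 0 < C by exact: mainC_gt0.
(* [weighted_sobolev] bounds the integral by C J^(pstar / p), J being the double integral; the power
   p / pstar makes J linear and turns C into C^(p / pstar). *)
exists (C `^ (p / pstar))^-1; split; first by rewrite invr_gt0 powR_gt0.
move=> u tu; have [M bu] := test_function_bounded tu.
have [su _ sO] := tu; have [cu _] := su [::].
have vO x : ~ Omega x -> u x = 0.
  by move=> nO; apply/eqP/negPn/negP => ux; apply/nO/sO; exact: subset_closure.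
rewrite -[leRHS]/(\int[lebesgue_rV N]_y energy p s u y)%E.
set J := (\int[_]_y _)%E.
have J0 : (0 <= J)%E by apply: integral_ge0 => y _; exact: energy_ge0.
(* An infinite energy makes the inequality trivial; otherwise J is a real number, as
   [weighted_sobolev] requires. *)
have [->|Jy] := eqVneq J +oo%E; first by rewrite leey.
have EE : J = (fine J)%:E by rewrite fineK // ge0_fin_numE // ltey.
have H := weighted_sobolev p1 hs0 hN pr D0 aN (open_measurable_rV oOmega)
  HD cu bu vO EE.
have E0 : 0 <= fine J by rewrite fine_ge0.
set I := (\int[_]_(x in Omega) _)%E.
have I0 : (0 <= I)%E.
  by apply: integral_ge0 => x _; rewrite lee_fin divr_ge0 // powR_ge0.
have pr0 : 0 <= p / pstar by rewrite divr_ge0 // ltW.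
have CE : (0 <= (C * fine J `^ (pstar / p))%:E)%E.
  by rewrite lee_fin mulr_ge0 ?powR_ge0 // ltW.
have : (I `^ (p / pstar) <= (C * fine J `^ (pstar / p))%:E `^ (p / pstar))%E.
  by apply: gt0_ler_poweR => //; rewrite in_itv/= leey ?I0 ?CE.
rewrite poweR_EFin powRM ?powR_ge0 ?(ltW C0) // -powRrM.
have -> : pstar / p * (p / pstar) = 1 by field; rewrite !gt_eqF.
rewrite powRr1 // => HI; rewrite EE.
apply: le_trans (lee_wpmul2l _ HI) _; first by rewrite lee_fin invr_ge0 powR_ge0.
by rewrite -EFinM lee_fin mulKf // gt_eqF // powR_gt0.
Qed.
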